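(* Every degree-structural property (with its scope $\sigma$ and max-degree $\Delta$, which are fixed positive integers) is affine-invariant and locally characterized.
   Context: Fix a prime $p$, $\mathbb{F}=\mathbb{F}_p$. Polynomials here are ordinary $\mathbb{F}$-valued polynomial functions $\mathbb{F}^n\to\mathbb{F}$. Given an integer $c>0$, $\mathbf d=(d_1,\dots,d_c)\in\mathbb{Z}_{\ge0}^c$ and $\Gamma:\mathbb{F}^c\to\mathbb{F}$, a function $F:\mathbb{F}^n\to\mathbb{F}$ is $(c,\mathbf d,\Gamma)$-structured if there are polynomials $P_1,\dots,P_c:\mathbb{F}^n\to\mathbb{F}$ with $\deg P_i\le d_i$ and $F(x)=\Gamma(P_1(x),\dots,P_c(x))$ for all $x$. A property $\mathcal P$ (a set of functions $\mathbb{F}^n\to\mathbb{F}$, over all $n\ge0$) is degree-structural if there are integers $\sigma,\Delta>0$ and a set $S\subseteq\{(c,\mathbf d,\Gamma): c\in[\sigma],\ \mathbf d\in\{0,\dots,\Delta\}^c,\ \Gamma:\mathbb{F}^c\to\mathbb{F}\}$ such that $F\in\mathcal P$ iff $F$ is $(c,\mathbf d,\Gamma)$-structured for some $(c,\mathbf d,\Gamma)\in S$; $\sigma$ is the scope and $\Delta$ the max-degree. $\mathcal P$ is affine-invariant if $F\in\mathcal P$ implies $F\circ A\in\mathcal P$ for every affine map $A:\mathbb{F}^n\to\mathbb{F}^n$. A hyperplane is an affine subspace of codimension 1; the restriction of $F$ to a hyperplane is regarded as a function on $\mathbb{F}^{n-1}$ via an affine isomorphism (well defined for affine-invariant properties).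 An affine-invariant property is locally characterized if (i) for every $F:\mathbb{F}^n\to\mathbb{F}$ in $\mathcal P$ and every hyperplane $A\le\mathbb{F}^n$, $F|_A\in\mathcal P$; and (ii) there is a constant $K\ge1$ such that whenever $F:\mathbb{F}^n\to\mathbb{F}$ is not in $\mathcal P$ and $n>K$, there is a hyperplane $B\le\mathbb{F}^n$ with $F|_B\notin\mathcal P$. *)

(* Defs.v *)
(* MathComp, with multivariate polynomials from multinomials. *)
From HB Require Import structures.
From mathcomp Require Import all_boot all_order all_algebra.
From mathcomp.multinomials Require Import mpoly.
Set Implicit Arguments.
Unset Strict Implicit.
Unset Printing Implicit Defensive.
Import GRing.Theory.
Local Open Scope ring_scope.

(* [msize q] is 1 + the total degree of q (and 0 for q = 0).  A polynomial
   function has degree at most d iff some polynomial of total degree at most d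
   represents it; formal representatives are not unique, since x^p = x on F_p. *)
Definition poly_fun_deg_le (p n d : nat) (P : 'rV['F_p]_n -> 'F_p) : Prop :=
  exists q : {mpoly 'F_p[n]},
    (msize q <= d.+1)%N /\ forall x, P x = q.@[fun i => x 0 i].

Definition structured (p c : nat) (d : 'I_c -> nat) (Gamma : 'rV['F_p]_c -> 'F_p)
    (n : nat) (F : 'rV['F_p]_n -> 'F_p) : Prop :=
  exists P : 'I_c -> 'rV['F_p]_n -> 'F_p,
    (forall i, poly_fun_deg_le (d i) (P i)) /\
    (forall x, F x = Gamma (\row_i P i x)).

Definition property (p : nat) : Type :=
  forall n : nat, ('rV['F_p]_n -> 'F_p) -> Prop.

(* A set of triples (c, d, Gamma), as a predicate. *)
Definition triple_set (p : nat) : Type :=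
  forall c : nat, ('I_c -> nat) -> ('rV['F_p]_c -> 'F_p) -> Prop.

Definition degree_structural (p sigma Delta : nat) (PP : property p) : Prop :=
  exists S : triple_set p,
    (forall c d Gamma, S c d Gamma ->
       (1 <= c <= sigma)%N /\ forall i, (d i <= Delta)%N) /\
    (forall n (F : 'rV['F_p]_n -> 'F_p),
       PP n F <-> exists c d Gamma, S c d Gamma /\ structured d Gamma F).

Definition affine_map (p m n : nat) (A : 'rV['F_p]_m -> 'rV['F_p]_n) : Prop :=
  exists (M : 'M['F_p]_(m, n)) (b : 'rV['F_p]_n), forall x, A x = x *m M + b.

Definition affine_invariant (p : nat) (PP : property p) : Prop :=
  forall n (F : 'rV['F_p]_n -> 'F_p) (A : 'rV['F_p]_n -> 'rV['F_p]_n),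
    PP n F -> affine_map A -> PP n (F \o A).

(* There is no hyperplane when n = 0. *)
Definition hyperplane (p n : nat) (H : {set 'rV['F_p]_n}) : Prop :=
  exists (v : 'rV['F_p]_n) (U : {vspace 'rV['F_p]_n}),
    (\dim U).+1 = n /\ H = [set v + u | u in U].

(* G is the restriction of F to H, read on F_p^(n-1) through some affine
   isomorphism onto H. *)
Definition restriction (p n : nat) (F : 'rV['F_p]_n -> 'F_p)
    (H : {set 'rV['F_p]_n}) (G : 'rV['F_p]_n.-1 -> 'F_p) : Prop :=
  exists phi : 'rV['F_p]_n.-1 -> 'rV['F_p]_n,
    [/\ affine_map phi, injective phi, [set phi x | x in setT] = H
      & forall x, G x = F (phi x)].

(* Both clauses quantify over all affine identifications of the hyperplane with
   F_p^(n-1); for affine-invariant properties the choice is immaterial. *)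
Definition locally_characterized (p : nat) (PP : property p) : Prop :=
  (forall n (F : 'rV['F_p]_n -> 'F_p) (H : {set 'rV['F_p]_n}),
     PP n F -> hyperplane H -> forall G, restriction F H G -> PP n.-1 G) /\
  (exists K : nat, (1 <= K)%N /\
     forall n (F : 'rV['F_p]_n -> 'F_p), ~ PP n F -> (K < n)%N ->
       exists H : {set 'rV['F_p]_n},
         hyperplane H /\ forall G, restriction F H G -> ~ PP n.-1 G).

(* Main.v *)
(* Call f a restriction of g when f = g o A for a linear map A.  The point is that
   tuples of polynomial functions of bounded degree are well-quasi-ordered by
   restriction, a finite-field analogue of Draisma's noetherianity theorem.

   Granting this, suppose that for infinitely many n there is a function F_n
   outside P all of whose hyperplane restrictions are in P.  Slicing by p
   parallel hyperplanes writes each F_n as Gamma_n(g_n), where g_n is a tuple of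
   polynomials whose length and degrees do not depend on n; pass to a
   subsequence on which Gamma_n is constant.  Then some g_i is a restriction of
   g_j with i < j along a linear map into a space of larger dimension, so F_i is
   a restriction of F_j to a hyperplane, and F_i is in P after all.

   The well-quasi-order is proved modulo an arbitrary subfunctor B, by induction
   on the degree k and on the number of functions on F_p^k outside B.  Given a
   bad sequence f_j, call y recurrent if it is a restriction of infinitely many
   f_j, and choose a recurrent x for which the set of e on F_p^k with
   x(w) + e(u) recurrent is as small as possible; after thinning out the
   sequence, the recurrent functions are stable under adding pullbacks of such
   e.  If some such e lies outside B, these e enlarge B, contradicting the inner
   induction.  To produce e, pull f_j back to z_j(w, v) extending x and
   apply the induction on the degree to the differences z_j(w, v) - z_j(0, v):
   this yields recurrent extensions y and y + e of x, differing by some e outside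
   B which depends only on the new variables.  Iterate this N times;
   Chevalley-Warning then gives a nonzero t in F_p^N along which the last
   extension restricts to x, while the term e survives. *)
Require Import Defs.
From mathcomp Require Import all_boot all_order all_algebra.
From mathcomp Require Import finfield boolp.
From mathcomp.multinomials Require Import mpoly.

(** * Differences and degree *)

Section Differences.
Set Implicit Arguments.
Unset Strict Implicit.
Unset Printing Implicit Defensive.
Import GRing.Theory.
Local Open Scope ring_scope.

Definition diff (V W : zmodType) (h : V) (f : V -> W) : V -> W :=
  fun v => f (v + h) - f v.

(** Degree below k means that all k-fold differences vanish. This is intrinsic to the function,
    whereas representing polynomials are not unique, and [diff] lowers it by one. *)
Fixpoint deg_lt (V W : zmodType) (k : nat) (f : V -> W) : Prop :=
  if k is k'.+1 then forall h, deg_lt k' (diff h f)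
  else forall v, f v = 0.

Lemma deg_lt_ext (V W : zmodType) k (f g : V -> W) :
  f =1 g -> deg_lt k f -> deg_lt k g.
Proof.
elim: k f g => [|k IH] f g fg /= Hf; first by move=> v; rewrite -fg.
by move=> h; apply: IH (Hf h) => v; rewrite /diff !fg.
Qed.

Lemma deg_ltW (V W : zmodType) k (f : V -> W) : deg_lt k f -> deg_lt k.+1 f.
Proof.
elim: k f => [|k IH] f Hf h; last exact/IH/Hf.
by move=> v; rewrite /diff !Hf subr0.
Qed.

Lemma deg_lt_leq (V W : zmodType) k l (f : V -> W) :
  (k <= l)%N -> deg_lt k f -> deg_lt l f.
Proof.
move=> /subnK <-; elim: (l - k)%N => // n IH Hf; exact/deg_ltW/IH.
Qed.

Lemma deg_lt0 (V W : zmodType) k : deg_lt k (fun _ : V => 0 : W).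
Proof. exact: (@deg_lt_leq _ _ 0). Qed.

Lemma deg_lt_const (V W : zmodType) k (c : W) : deg_lt k.+1 (fun _ : V => c).
Proof. by apply: (@deg_lt_leq _ _ 1) => // h v; rewrite /diff subrr. Qed.

Lemma deg_ltD (V W : zmodType) k (f g : V -> W) :
  deg_lt k f -> deg_lt k g -> deg_lt k (fun v => f v + g v).
Proof.
elim: k f g => [|k IH] f g Hf Hg; first by move=> v; rewrite Hf Hg addr0.
move=> h; apply: deg_lt_ext (IH _ _ (Hf h) (Hg h)) => v.
by rewrite /diff opprD addrACA.
Qed.

Lemma deg_ltN (V W : zmodType) k (f : V -> W) :
  deg_lt k f -> deg_lt k (fun v => - f v).
Proof.
elim: k f => [|k IH] f Hf; first by move=> v; rewrite Hf oppr0.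
by move=> h; apply: deg_lt_ext (IH _ (Hf h)) => v; rewrite /diff opprD.
Qed.

Lemma deg_ltB (V W : zmodType) k (f g : V -> W) :
  deg_lt k f -> deg_lt k g -> deg_lt k (fun v => f v - g v).
Proof. by move=> Hf Hg; apply/deg_ltD/deg_ltN. Qed.

Lemma deg_lt_sum (V W : zmodType) k (T : eqType) (r : seq T) (F : T -> V -> W) :
  (forall i, i \in r -> deg_lt k (F i)) -> deg_lt k (fun v => \sum_(i <- r) F i v).
Proof.
elim: r => [|i r IH] HF.
  by apply: deg_lt_ext (deg_lt0 V W k) => v; rewrite big_nil.
have Hr : deg_lt k (fun v => \sum_(i <- r) F i v).
  by apply: IH => j jr; apply: HF; rewrite inE jr orbT.
apply: deg_lt_ext (deg_ltD (HF i (mem_head _ _)) Hr) => v.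
by rewrite big_cons.
Qed.

Lemma deg_lt_comp (U V W : zmodType) k (f : V -> W) (A L : U -> V) :
  (forall v h, A (v + h) = A v + L h) -> deg_lt k f -> deg_lt k (f \o A).
Proof.
move=> AL; elim: k f => [|k IH] f Hf; first by move=> v; apply: Hf.
by move=> h; apply: deg_lt_ext (IH _ (Hf (L h))) => v; rewrite /diff /= AL.
Qed.

Lemma deg_lt_shift (V W : zmodType) k (f : V -> W) h :
  deg_lt k f -> deg_lt k (fun v => f (v + h)).
Proof.
by apply: (@deg_lt_comp _ _ _ _ _ (fun v => v + h) id) => v l; rewrite addrAC.
Qed.

(** Induction on k + l by the Leibniz rule: the difference of f g is diff(f) times the shifted g,
    plus f times diff(g). *)
Lemma deg_ltM (V : zmodType) (W : comNzRingType) k l (f g : V -> W) :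
  deg_lt k.+1 f -> deg_lt l.+1 g -> deg_lt (k + l).+1 (fun v => f v * g v).
Proof.
move: {2}(k + l)%N (erefl (k + l)%N) => n; elim: n k l f g => [|n IH] k l f g.
  case: k => //; case: l => // _ Hf Hg h v.
  have fE : f (v + h) = f v by apply/eqP; rewrite -subr_eq0; apply/eqP/(Hf h v).
  have gE : g (v + h) = g v by apply/eqP; rewrite -subr_eq0; apply/eqP/(Hg h v).
  by rewrite /diff fE gE subrr.
move=> kl Hf Hg h; rewrite kl.
have Hf' : deg_lt n.+1 (fun v => diff h f v * g (v + h)).
  have Hgh := deg_lt_shift h Hg.
  case: k kl Hf => [|k] kl Hf; last first.
    by case: kl => kl; rewrite -kl; apply: IH (kl) (Hf h) Hgh.
  apply: deg_lt_ext (deg_lt0 V W n.+1) => v.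
  by rewrite (_ : diff h f v = 0) ?mul0r; last exact: (Hf h v).
have Hg' : deg_lt n.+1 (fun v => f v * diff h g v).
  case: l kl Hg {Hf'} => [|l] kl Hg; last first.
    rewrite addnS in kl; case: kl => kl; rewrite -kl.
    by apply: IH (kl) Hf (Hg h).
  apply: deg_lt_ext (deg_lt0 V W n.+1) => v.
  by rewrite (_ : diff h g v = 0) ?mulr0; last exact: (Hg h v).
apply: deg_lt_ext (deg_ltD Hf' Hg') => v.
by rewrite /diff mulrBl mulrBr addrA subrK.
Qed.

Lemma deg_lt_prod (V : zmodType) (W : comNzRingType) (T : Type) (r : seq T)
    (k : T -> nat) (F : T -> V -> W) :
  (forall i, deg_lt (k i).+1 (F i)) ->
  deg_lt (\sum_(i <- r) k i).+1 (fun v => \prod_(i <- r) F i v).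
Proof.
move=> HF; elim: r => [|i r IH].
  rewrite big_nil.
  by apply: (deg_lt_ext _ (@deg_lt_const V W 0 1)) => v; rewrite big_nil.
rewrite big_cons; apply: (deg_lt_ext _ (deg_ltM (HF i) IH)) => v.
by rewrite big_cons.
Qed.

Lemma deg_ltX (V : zmodType) (W : comNzRingType) k n (f : V -> W) :
  deg_lt k.+1 f -> deg_lt (n * k).+1 (fun v => f v ^+ n).
Proof.
move=> Hf; have := deg_lt_prod (iota 0 n) (fun=> Hf).
rewrite big_const_seq count_predT size_iota iter_addn_0 mulnC.
apply: deg_lt_ext => v.
by rewrite big_const_seq count_predT size_iota iter_mulr_1.
Qed.

Lemma deg_lt_iter_diff (V W : zmodType) k n (f : V -> W) h :
  deg_lt (n + k) f -> deg_lt k (iter n (diff h) f).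
Proof. by elim: n f => //= n IH f Hf; rewrite -iterS iterSr; apply/IH/Hf. Qed.

(** Newton's forward-difference formula, by Pascal's rule. *)
Lemma sum_line (V W : zmodType) n (f : V -> W) h v :
  \sum_(a < n) f (v + h *+ a) = \sum_(j < n) iter j (diff h) f v *+ 'C(n, j.+1).
Proof.
elim: n f v => [|n IH] f v; first by rewrite !big_ord0.
rewrite big_ord_recl mulr0n addr0.
have -> : \sum_(i < n) f (v + h *+ lift ord0 i) =
          \sum_(i < n) (f (v + h *+ i) + diff h f (v + h *+ i)).
  apply: eq_bigr => i _; rewrite /diff [RHS]addrC subrK; congr f.
  by rewrite lift0 mulrSr addrA.
rewrite big_split /= !IH.
under [X in _ + (_ + X)]eq_bigr do rewrite -iterSr.
under [RHS]eq_bigr do rewrite binS mulrnDr.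
rewrite [RHS]big_split /= [X in _ = X + _]big_ord_recr /= bin_small // mulr0n addr0.
by rewrite [X in _ = _ + X]big_ord_recl /= bin0 mulr1n addrCA.
Qed.

End Differences.

(** * The Chevalley-Warning theorem *)

Section ChevalleyWarning.
Set Implicit Arguments.
Unset Strict Implicit.
Unset Printing Implicit Defensive.
Import GRing.Theory.
Local Open Scope ring_scope.

Variables (p : nat) (p_prime : prime p).

Lemma Fp_mulrn (x : 'F_p) : x *+ p = 0.
Proof. by rewrite -mulr_natr pchar_Fp_0 // mulr0. Qed.

Lemma sum_Fp (W : zmodType) (g : 'F_p -> W) :
  \sum_(a : 'F_p) g a = \sum_(a < p) g a%:R.
Proof.
have inj : injective (fun a : 'I_p => a%:R : 'F_p).
  move=> a b /(congr1 (@nat_of_ord _)); rewrite !val_Fp_nat // !modn_small //.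
  exact: val_inj.
rewrite (reindex (fun a : 'I_p => a%:R : 'F_p)) //.
apply/onW_bij/inj_card_bij => //.
by rewrite card_Fp ?card_ord.
Qed.

(** By [sum_line] the sum over a full line is a (p-1)-fold difference, as p divides the other
    binomial coefficients. *)
Lemma deg_lt_sum_line (V : zmodType) k (f : V -> 'F_p) h :
  deg_lt (p.-1 + k) f -> deg_lt k (fun v => \sum_(a < p) f (v + h *+ a)).
Proof.
move=> /deg_lt_iter_diff - /(_ h); apply: deg_lt_ext => v.
rewrite sum_line; set G := fun j => iter j (diff h) f v *+ 'C(p, j.+1).
have -> : \sum_(j < p) G j = \sum_(j < p.-1.+1) G j.
  by rewrite prednK ?prime_gt0.
rewrite big_ord_recr /= {2}/G prednK ?prime_gt0 // binn mulr1n.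
rewrite big1 ?add0r // => j _.
have jp : (0 < j.+1 < p)%N.
  by have := ltn_ord j; rewrite -ltnS (prednK (prime_gt0 p_prime)).
by rewrite /G; have /dvdnP[c ->] := prime_dvd_bin p_prime jp; rewrite mulrnA Fp_mulrn.
Qed.

(** Summing out one coordinate lowers the degree by p - 1 and leaves one coordinate fewer; for N = 0
    the hypothesis says f = 0. *)
Lemma sum_deg_lt N (f : 'rV['F_p]_N -> 'F_p) :
  deg_lt (p.-1 * N) f -> \sum_t f t = 0.
Proof.
elim: N f => [|N IH] f Hf.
  by apply: big1 => t _; move: Hf; rewrite muln0; apply.
pose h := row_mx 1%:M 0 : 'rV['F_p]_(1 + N).
pose g (t : 'rV['F_p]_N) := \sum_(a < p) f (row_mx 0 t + h *+ a).
have Hg : deg_lt (p.-1 * N) g.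
  apply: (@deg_lt_comp _ _ _ _ (fun v => \sum_(a < p) f (v + h *+ a))
    (row_mx 0) (row_mx 0)) => [u v|]; first by rewrite add_row_mx addr0.
  by apply: deg_lt_sum_line; rewrite -mulnS.
transitivity (\sum_t g t); last exact: IH.
rewrite (reindex (fun at_ : 'F_p * 'rV['F_p]_N =>
    row_mx 0 at_.2 + at_.1 *: h : 'rV_(1 + N))) /=; last first.
  exists (fun v : 'rV_(1 + N) => (lsubmx v 0 0, rsubmx v)) => [[a t]|v] _ /=.
    rewrite /h scale_row_mx add_row_mx row_mxKl row_mxKr.
    by rewrite !mxE eqxx mulr1 add0r scaler0 addr0.
  rewrite /h scale_row_mx add_row_mx scaler0 addr0 add0r -[RHS]hsubmxK.
  by congr row_mx; apply/rowP => i; rewrite !mxE !ord1 eqxx mulr1.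
transitivity (\sum_(a : 'F_p) \sum_(t : 'rV['F_p]_N) f (row_mx 0 t + a *: h)).
  by rewrite pair_bigA.
rewrite exchange_big /=; apply: eq_bigr => t _; rewrite sum_Fp.
by apply: eq_bigr => a _; rewrite scaler_nat.
Qed.

(* Chevalley-Warning: t |-> \prod_j (1 - (g t j - g 0 j)^(p-1)) is the indicator
   of the solution set, and has too small a degree to have a nonzero sum. *)
Lemma chevalley_warning k N (J : finType) (g : 'rV['F_p]_N -> J -> 'F_p) :
  (forall j, deg_lt k.+1 (fun t => g t j)) -> (#|J| * k < N)%N ->
  exists2 t, t != 0 & forall j, g t j = g 0 j.
Proof.
move=> Hg kN.
pose f t := \prod_(j <- enum J) (1 - (g t j - g 0 j) ^+ p.-1).
have p1 : (0 < p.-1)%N by rewrite -ltnS prednK ?prime_gt1 ?prime_gt0.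
have Hf : deg_lt (p.-1 * N) f.
  apply: (@deg_lt_leq _ _ (\sum_(j <- enum J) (p.-1 * k)).+1).
    rewrite big_const_seq count_predT -cardE iter_addn_0.
    by rewrite mulnC mulnCA ltn_mul2l p1.
  apply: deg_lt_prod => j; apply: deg_ltB; first exact: deg_lt_const.
  apply/deg_ltX/deg_ltB => //; exact: deg_lt_const.
have fP t : f t = (if [forall j, g t j == g 0 j] then 1 else 0).
  case: ifP => [/forallP all0|/negbT/forallPn[j gj]].
    by apply: big1 => j _; rewrite (eqP (all0 j)) subrr expr0n gtn_eqF ?subr0.
  rewrite /f (big_rem j) ?mem_enum //=.
  suff -> : (g t j - g 0 j) ^+ p.-1 = 1 by rewrite subrr mul0r.
  have nz : g t j - g 0 j != 0 by rewrite subr_eq0.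
  apply: (mulfI nz); rewrite -exprS prednK ?prime_gt0 // mulr1.
  by rewrite -{2}(expf_card (g t j - g 0 j)) card_Fp.
case: (pickP (fun t => (t != 0) && [forall j, g t j == g 0 j])).
  by move=> t /andP[t0 /forallP gt]; exists t => // j; exact/eqP.
(* Were 0 the only solution, the sum of f would be f(0) = 1. *)
move=> none; have := sum_deg_lt Hf.
rewrite (bigD1 0) //= big1 ?addr0 => [|t t0]; last first.
  by rewrite fP; have := none t; rewrite t0 /= => ->.
rewrite fP ifT; first by move/eqP; rewrite oner_eq0.
by apply/forallP.
Qed.

End ChevalleyWarning.

(** * Functors of polynomial functions *)

Section Functors.
Set Implicit Arguments.
Unset Strict Implicit.
Unset Printing Implicit Defensive.
Import GRing.Theory.
Local Open Scope ring_scope.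

Variables (p : nat) (p_prime : prime p).

Local Notation fn I n := {ffun ('rV['F_p]_n * I)%type -> 'F_p}.

Definition pull (I : finType) m n (M : 'M['F_p]_(m, n)) (f : fn I n) : fn I m :=
  [ffun vi => f (vi.1 *m M, vi.2)].

Definition fn_deg_lt (I : finType) n k (f : fn I n) : Prop :=
  forall i, deg_lt k (fun v => f (v, i)).

Record subfunctor (I : finType) (k : nat) (B : forall n, fn I n -> Prop) := {
  sub0 : forall n, B n 0;
  subD : forall n f g, B n f -> B n g -> B n (f + g);
  sub_pull : forall m n (M : 'M['F_p]_(m, n)) f, B n f -> B m (pull M f);
  sub_deg : forall n f, B n f -> fn_deg_lt k f }.

Section Pull.
Variable I : finType.

Lemma pullD m n (M : 'M['F_p]_(m, n)) (f g : fn I n) :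
  pull M (f + g) = pull M f + pull M g.
Proof. by apply/ffunP => vi; rewrite !ffunE. Qed.

Lemma pullB m n (M : 'M['F_p]_(m, n)) (f g : fn I n) :
  pull M (f - g) = pull M f - pull M g.
Proof. by apply/ffunP => vi; rewrite !ffunE. Qed.

Lemma pull0 m n (M : 'M['F_p]_(m, n)) : pull M (0 : fn I n) = 0.
Proof. by apply/ffunP => vi; rewrite !ffunE. Qed.

Lemma pull_pull l m n (A : 'M['F_p]_(l, m)) (M : 'M['F_p]_(m, n)) (f : fn I n) :
  pull A (pull M f) = pull (A *m M) f.
Proof. by apply/ffunP => vi; rewrite !ffunE mulmxA. Qed.

Lemma pull1 n (f : fn I n) : pull 1%:M f = f.
Proof. by apply/ffunP => -[v i]; rewrite !ffunE mulmx1. Qed.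

Lemma fn_deg_lt_pull k m n (M : 'M['F_p]_(m, n)) (f : fn I n) :
  fn_deg_lt k f -> fn_deg_lt k (pull M f).
Proof.
move=> Hf i; have := deg_lt_comp (A := fun v => v *m M) (L := fun v => v *m M)
  (fun v h => mulmxDl v h M) (Hf i).
by apply: deg_lt_ext => v /=; rewrite ffunE.
Qed.

Lemma fn_deg_ltD k n (f g : fn I n) :
  fn_deg_lt k f -> fn_deg_lt k g -> fn_deg_lt k (f + g).
Proof.
by move=> Hf Hg i; apply: deg_lt_ext (deg_ltD (Hf i) (Hg i)) => v; rewrite ffunE.
Qed.

Lemma fn_deg_ltB k n (f g : fn I n) :
  fn_deg_lt k f -> fn_deg_lt k g -> fn_deg_lt k (f - g).
Proof.
by move=> Hf Hg i; apply: deg_lt_ext (deg_ltB (Hf i) (Hg i)) => v; rewrite !ffunE.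
Qed.

Lemma fn_deg_lt0 k n : fn_deg_lt k (0 : fn I n).
Proof.
by move=> i; apply: deg_lt_ext (@deg_lt0 _ _ k) => v; rewrite ffunE.
Qed.

End Pull.

(** * Membership in a subfunctor is detected on few variables *)

Section Subfunctor.
Variables (I : finType) (k : nat) (B : forall n, fn I n -> Prop).
Arguments B {n}.
Hypothesis HB : subfunctor k (@B).

Lemma subN n (f : fn I n) : B f -> B (- f).
Proof.
move=> Bf; have -> : - f = f *+ p.-1.
  apply/eqP; rewrite -subr_eq0 -opprD oppr_eq0 -mulrS prednK ?prime_gt0 //.
  by apply/eqP/ffunP => vi; rewrite ffunMnE Fp_mulrn // ffunE.
by elim: p.-1 => [|n' IH]; [apply: (sub0 HB) | rewrite mulrS; apply: (subD HB)].
Qed.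

Lemma subB n (f g : fn I n) : B f -> B g -> B (f - g).
Proof. by move=> Bf Bg; apply: (subD HB) => //; apply: subN. Qed.

Lemma sub_opp n (f g : fn I n) : B (f - g) -> B (g - f).
Proof. by move/subN; rewrite opprB. Qed.

(** The iterated difference of C |-> [pull C e] in the matrix directions [l]: a signed sum of
    [pull (C + S) e], with S running over the sums of sublists of [l]. *)
Fixpoint altsum n (e : fn I n) (l : seq 'M['F_p]_n) (C : 'M['F_p]_n) : fn I n :=
  if l is M :: l' then altsum e l' (C + M) - altsum e l' C else pull C e.

(** At a fixed row v the direction M acts as translation by v M, so this is a [size l]-fold
    difference of e. *)
Lemma altsum0 n (e : fn I n) l C : fn_deg_lt (size l) e -> altsum e l C = 0.
Proof.
move=> He; apply/ffunP => -[v i].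
have -> : altsum e l C (v, i) =
    foldr (fun M h => diff (v *m M) h) (fun u => e (u, i)) l (v *m C).
  elim: l C {He} => [|M l IH] C /=; first by rewrite ffunE.
  by rewrite !ffunE !IH /diff mulmxDr.
suff H m (h : _ -> 'F_p) : deg_lt (size l + m) h ->
    deg_lt m (foldr (fun M h => diff (v *m M) h) h l).
  rewrite (H 0%N) ?ffunE // addn0; exact: He.
elim: l m {He} => //= M l IH m.
by move=> Hh; apply: (IH m.+1); rewrite addnS.
Qed.

Definition rank_one n (M : 'M['F_p]_n) :=
  exists (u : 'cV['F_p]_n) (w : 'rV['F_p]_n), M = u *m w.

Lemma sum_rank_one n (l : seq 'M['F_p]_n) :
  (forall M, M \in l -> rank_one M) ->
  exists (A : 'M_(n, size l)) (C : 'M_(size l, n)), \sum_(M <- l) M = A *m C.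
Proof.
elim: l => [|M l IH] Hl; first by exists 0, 0; rewrite big_nil mul0mx.
have [u [w ->]] := Hl M (mem_head _ _).
have [|A [C E]] := IH; first by move=> N Nl; apply: Hl; rewrite inE Nl orbT.
by exists (row_mx u A), (col_mx w C); rewrite big_cons E -mul_row_col.
Qed.

Lemma sub_altsum n (e : fn I n) l1 l2 :
  (forall M, M \in l1 ++ l2 -> rank_one M) ->
  (forall l, (forall M, M \in l -> rank_one M) ->
     (size l <= size l1 + size l2)%N -> B (pull (\sum_(M <- l) M) e)) ->
  B (altsum e l1 (\sum_(M <- l2) M)).
Proof.
elim: l1 l2 => [|M l1 IH] l2 Hl Hs /=; first exact: Hs.
apply: subB; last first.
  apply: IH => [N Nl|l ll sl].
    by apply: Hl; rewrite cat_cons in_cons Nl orbT.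
  by apply: Hs => //; apply: leq_trans sl _; rewrite addSn.
rewrite addrC -(big_cons _ _ _ _ xpredT id); apply: IH => [N Nl|l ll sl].
  by apply: Hl; move: Nl; rewrite cat_cons !(in_cons, mem_cat) orbCA.
by apply: Hs => //; rewrite /= addSnnS.
Qed.

(** Only the sublist taking all of [l1] gives the full sum, with sign +; every other term is a
    pullback along a shorter sum, hence in B. The list [l2] holds the matrices already taken. *)
Lemma sub_altsumB n (e : fn I n) l1 l2 :
  (forall M, M \in l1 ++ l2 -> rank_one M) ->
  (forall l, (forall M, M \in l -> rank_one M) ->
     (size l < size l1 + size l2)%N -> B (pull (\sum_(M <- l) M) e)) ->
  B (altsum e l1 (\sum_(M <- l2) M) - pull (\sum_(M <- l1 ++ l2) M) e).
Proof.
elim: l1 l2 => [|M l1 IH] l2 Hl Hs /=; first by rewrite subrr; apply: (sub0 HB).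
rewrite addrAC; apply: subB; last first.
  apply: sub_altsum => [N Nl|l ll sl].
    by apply: Hl; rewrite cat_cons in_cons Nl orbT.
  by apply: Hs => //; rewrite addSn ltnS.
rewrite [_ + M]addrC -(big_cons _ _ _ _ xpredT id).
have -> : \sum_(N <- M :: l1 ++ l2) N = \sum_(N <- l1 ++ M :: l2) N.
  exact: perm_big (permEl (perm_catCA [:: M] l1 l2)).
apply: IH => [N Nl|l ll sl].
  by apply: Hl; move: Nl; rewrite cat_cons !(in_cons, mem_cat) orbCA.
by apply: Hs => //; rewrite /= addSnnS.
Qed.

End Subfunctor.

(* The alternating sum over the sublists of k+1 rank-one matrices vanishes, so
   a pullback of [e] along a sum of more than k of them is a combination of
   pullbacks along shorter sums, and finally along maps through 'F_p^k. *)
Lemma sub_generated (I : finType) k (B : forall n, fn I n -> Prop) n (e : fn I n) :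
  subfunctor k.+1 B -> fn_deg_lt k.+1 e ->
  (forall C : 'M['F_p]_(k, n), B k (pull C e)) -> B n e.
Proof.
move=> HB He HC; rewrite -(pull1 e).
have -> : 1%:M = \sum_(M <- [seq delta_mx i i | i <- enum 'I_n]) M :> 'M['F_p]_n.
  by rewrite big_map mx1_sum_delta big_enum.
have : forall M, M \in [seq delta_mx i i | i <- enum 'I_n] -> @rank_one n M.
  move=> M /mapP[i _ ->]; exists (delta_mx i 0), (delta_mx 0 i).
  by rewrite mul_delta_mx.
move: [seq _ | _ <- _] => l; move: {2}(size l).+1 (ltnSn (size l)) => s.
elim: s l => // s IH l ls Hl.
have [lk|kl] := leqP (size l) k.
  (* The sum factors through F_p^(size l); padding with zero rows reaches F_p^k. *)
  have [A [C ->]] := sum_rank_one Hl; rewrite -pull_pull; apply: (sub_pull HB).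
  have := HC (castmx (subnKC lk, erefl n) (col_mx C 0)).
  move/(sub_pull HB (castmx (erefl _, subnKC lk) (row_mx 1%:M 0))).
  rewrite pull_pull.
  have -> // : forall k' (E : (size l + (k - size l))%N = k'),
    castmx (erefl _, E) (row_mx 1%:M 0) *m castmx (E, erefl n) (col_mx C 0) = C.
  by move=> k' E; case: _ / E; rewrite !castmx_id mul_row_col mul1mx mul0mx addr0.
(* Since [altsum] vanishes here, the full pullback is minus the difference that [sub_altsumB] puts
   in B. *)
rewrite -{1}(cat_take_drop k.+1 l) -[X in B _ X]opprK; apply: (subN HB).
rewrite -[X in B _ X]add0r.
rewrite -(@altsum0 I n e (take k.+1 l) (\sum_(M <- drop k.+1 l) M)); last first.
  by rewrite size_takel.
apply: (sub_altsumB HB); rewrite ?cat_take_drop // => l' Hl' sl'.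
apply: IH => //; apply: leq_trans (sl') _.
by rewrite -size_cat cat_take_drop -ltnS.
Qed.

End Functors.

(** * Restriction modulo a subfunctor *)

Section WellQuasiOrder.
Set Implicit Arguments.
Unset Strict Implicit.
Unset Printing Implicit Defensive.
Import GRing.Theory.
Local Open Scope ring_scope.

Definition infinitely (P : nat -> Prop) := forall N, exists2 j, (N <= j)%N & P j.

Lemma infinitely_sub (P Q : nat -> Prop) :
  (forall j, P j -> Q j) -> infinitely P -> infinitely Q.
Proof. by move=> PQ HP N; have [j Nj /PQ Qj] := HP N; exists j. Qed.

Lemma infinitely_pigeonhole (T : finType) (R : nat -> T -> Prop) :
  infinitely (fun j => exists t, R j t) -> exists t, infinitely (R^~ t).
Proof.
move=> HR; apply: contrapT => /forallNP none.
have bnd t : exists N, forall j, (N <= j)%N -> ~ R j t.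
  have /existsNP[N HN] := none t; exists N => j Nj Rjt.
  by apply: HN; exists j.
have [b Hb] := choice bnd.
have [j bj [t Rjt]] := HR (\max_t b t)%N.
by apply: Hb Rjt; apply: leq_trans bj; apply: leq_bigmax.
Qed.

Variables (p : nat) (p_prime : prime p).

Local Notation fn I n := {ffun ('rV['F_p]_n * I)%type -> 'F_p}.

Definition le_mod (I : finType) (B : forall n, fn I n -> Prop) m n
    (f : fn I m) (g : fn I n) :=
  exists M : 'M['F_p]_(m, n), B m (f - pull M g).

Definition recurrent (I : finType) (B : forall n, fn I n -> Prop) (d : nat -> nat)
    (f : forall j, fn I (d j)) (J : nat -> Prop) n (y : fn I n) :=
  infinitely (fun j => J j /\ le_mod B y (f j)).

(** Stronger than finding one pair i < j: a single term lies below infinitely many. I, B and J are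
    quantified because the induction changes the index set, the subfunctor and the subsequence. *)
Definition wqo_at k := forall (I : finType) (B : forall n, fn I n -> Prop),
  subfunctor k B -> forall d (f : forall j, fn I (d j)) (J : nat -> Prop),
  (forall j, fn_deg_lt k (f j)) -> infinitely J ->
  exists2 i, J i & recurrent B f J (f i).

(** This is (v, u) |-> x(v) + e(u). *)
Definition oplus (I : finType) m n (x : fn I m) (e : fn I n) : fn I (m + n) :=
  pull (col_mx 1%:M 0) x + pull (col_mx 0 1%:M) e.

Lemma pull_oplus (I : finType) l m n (A : 'M['F_p]_(l, m)) (C : 'M['F_p]_(l, n))
    (x : fn I m) (e : fn I n) :
  pull (row_mx A C) (oplus x e) = pull A x + pull C e.
Proof.
by rewrite /oplus pullD !pull_pull !mul_row_col !mulmx1 !mulmx0 addr0 add0r.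
Qed.

(** * The preorder of restriction modulo B, and recurrent functions *)

Section Order.
Variables (I : finType) (k : nat) (B : forall n, fn I n -> Prop).
Arguments B {n}.
Hypothesis HB : subfunctor k (@B).
Local Notation "f <=B g" := (le_mod (@B) f g) (at level 70).

Lemma le_mod_congr n (f g : fn I n) : B (f - g) -> f <=B g.
Proof. by move=> fg; exists 1%:M; rewrite pull1. Qed.

Lemma le_mod_pull m n (M : 'M['F_p]_(m, n)) (f : fn I n) : pull M f <=B f.
Proof. by exists M; rewrite subrr; apply: (sub0 HB). Qed.

Lemma le_mod_trans l m n (f : fn I l) (g : fn I m) (h : fn I n) :
  f <=B g -> g <=B h -> f <=B h.
Proof.
move=> [M fg] [N gh]; exists (M *m N).
have := subD HB fg (sub_pull HB M gh).
by rewrite pullB pull_pull addrA subrK.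
Qed.

Lemma le_mod_oplus m n l (x : fn I m) (y : fn I n) (e : fn I l) :
  x <=B y -> oplus x e <=B oplus y e.
Proof.
move=> [M xy]; exists (block_mx M 0 0 1%:M).
have := sub_pull HB (col_mx 1%:M 0 : 'M_(m + l, m)) xy.
rewrite pullB pull_pull block_mxEh pull_oplus /oplus opprD addrACA subrr addr0.
by rewrite mul_col_mx mul1mx mul0mx.
Qed.

Section Sequence.
Variables (d : nat -> nat) (f : forall j, fn I (d j)).
Local Notation recurrent := (recurrent (@B) f).

Lemma recurrent_le (J : nat -> Prop) m n (x : fn I m) (y : fn I n) :
  x <=B y -> recurrent J y -> recurrent J x.
Proof.
by move=> xy; apply: infinitely_sub => j [Jj yf]; split=> //; apply: le_mod_trans yf.
Qed.

Lemma recurrent_sub (J J' : nat -> Prop) n (y : fn I n) :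
  (forall j, J j -> J' j) -> recurrent J y -> recurrent J' y.
Proof. by move=> JJ; apply: infinitely_sub => j [/JJ]. Qed.

Lemma recurrent_restrict (J : nat -> Prop) n (y : fn I n) :
  recurrent J y -> recurrent (fun j => J j /\ y <=B f j) y.
Proof. by apply: infinitely_sub => j []. Qed.

Lemma recurrent_infinitely (J : nat -> Prop) n (y : fn I n) :
  recurrent J y -> infinitely J.
Proof. by apply: infinitely_sub => j []. Qed.

Lemma recurrent_deg (J : nat -> Prop) n (y : fn I n) :
  (forall j, fn_deg_lt k (f j)) -> recurrent J y -> fn_deg_lt k y.
Proof.
move=> Hf /(_ 0%N)[j _ [_ [M /(sub_deg HB) yf]]].
by rewrite -(subrK (pull M (f j)) y); apply/fn_deg_ltD/fn_deg_lt_pull.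
Qed.

(* Pigeonhole: only finitely many functions on ['rV_(m + n)] restrict to [x]
   and [y]. *)
Lemma recurrent_join (J : nat -> Prop) m n (x : fn I m) (y : fn I n) :
  (forall j, J j -> x <=B f j) -> recurrent J y ->
  exists l (z : fn I l), [/\ recurrent J z, x <=B z & y <=B z].
Proof.
move=> Jx Jy; exists (m + n)%N.
have [|z Hz] := @infinitely_pigeonhole (fn I (m + n))
    (fun j z => J j /\ [/\ z <=B f j, x <=B z & y <=B z]).
  apply: infinitely_sub Jy => j [Jj [C yC]]; have [A xA] := Jx j Jj.
  exists (pull (col_mx A C) (f j)); split=> //; split; first exact: le_mod_pull.
    by exists (row_mx 1%:M 0); rewrite pull_pull mul_row_col mul1mx mul0mx addr0.
  by exists (row_mx 0 1%:M); rewrite pull_pull mul_row_col mul1mx mul0mx add0r.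
have [_ _ [_ [_ xz yz]]] := Hz 0%N.
by exists z; split=> //; apply: infinitely_sub Hz => j [Jj []].
Qed.

End Sequence.
End Order.

(** The differences z(a, v) - z(0, v) as functions of v, with the shift a moved into the index set,
    which stays finite because F_p^w is. They have one degree less. *)
Definition shift_diff (I : finType) w n (z : fn I (w + n)) :
    fn ('rV['F_p]_w * I)%type n :=
  [ffun vi => z (row_mx vi.2.1 vi.1, vi.2.2) - z (row_mx 0 vi.1, vi.2.2)].

Section ShiftDiff.
Variables (I : finType) (w : nat).

Lemma shift_diffD n (y z : fn I (w + n)) :
  shift_diff (y + z) = shift_diff y + shift_diff z.
Proof. by apply/ffunP => vi; rewrite !ffunE opprD addrACA. Qed.

Lemma shift_diffB n (y z : fn I (w + n)) :
  shift_diff (y - z) = shift_diff y - shift_diff z.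
Proof. by apply/ffunP => vi; rewrite !ffunE !opprD addrACA. Qed.

Lemma shift_diff_pull m n (M : 'M['F_p]_(m, n)) (z : fn I (w + n)) :
  pull M (shift_diff z) = shift_diff (pull (block_mx 1%:M 0 0 M) z).
Proof.
apply/ffunP => vi; rewrite !ffunE /= !mul_row_block.
by rewrite !mulmx1 !mulmx0 addr0 !add0r.
Qed.

Lemma shift_diff_deg k n (z : fn I (w + n)) :
  fn_deg_lt k.+1 z -> fn_deg_lt k (shift_diff z).
Proof.
move=> Hz [a i]; have AL v h :
    row_mx 0 (v + h) = row_mx 0 v + row_mx 0 h :> 'rV['F_p]_(w + n).
  by rewrite add_row_mx addr0.
apply: deg_lt_ext (deg_lt_comp AL (Hz i (row_mx a 0))) => v.
by rewrite ffunE /diff /= add_row_mx add0r addr0.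
Qed.

Lemma shift_diff_eq0 n (z : fn I (w + n)) :
  shift_diff z = 0 -> z = pull (col_mx 0 1%:M) (pull (row_mx 0 1%:M) z).
Proof.
move=> z0; apply/ffunP => -[v i]; rewrite !ffunE /= -[v]hsubmxK.
rewrite mul_row_col mulmx0 add0r mulmx1 mul_mx_row mulmx0 mulmx1.
have /ffunP/(_ (rsubmx v, (lsubmx v, i))) := z0.
by rewrite !ffunE /= => /eqP; rewrite subr_eq0 => /eqP.
Qed.

Lemma shift_diff_subfunctor k (B : forall n, fn I n -> Prop) :
  subfunctor k.+1 B ->
  subfunctor k (fun n g => exists2 b, B (w + n)%N b & g = shift_diff b).
Proof.
move=> HB; split.
- move=> n; exists 0; first exact: (sub0 HB).
  by apply/ffunP => vi; rewrite !ffunE subrr.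
- move=> n _ _ [b Bb ->] [c Bc ->]; exists (b + c); first exact: (subD HB).
  by rewrite shift_diffD.
- move=> m n M _ [b Bb ->]; exists (pull (block_mx 1%:M 0 0 M) b).
    exact: (sub_pull HB).
  by rewrite shift_diff_pull.
- by move=> n _ [b Bb ->]; apply/shift_diff_deg/(sub_deg HB).
Qed.

End ShiftDiff.

Lemma recurrent_extend (I : finType) k (B : forall n, fn I n -> Prop)
    (d : nat -> nat) (f : forall j, fn I (d j)) (J : nat -> Prop) w (x : fn I w) :
  wqo_at k -> subfunctor k.+1 B -> (forall j, fn_deg_lt k.+1 (f j)) ->
  (forall i, J i -> ~ recurrent B f J (f i)) -> recurrent B f J x ->
  exists (y : fn I (w + k)) (e : fn I k),
    [/\ fn_deg_lt k.+1 y, fn_deg_lt k.+1 e /\ ~ B k e,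
        B w (pull (row_mx 1%:M 0) y - x), recurrent B f J y
      & recurrent B f J (y + pull (col_mx 0 1%:M) e)].
Proof.
move=> IHk HB Hf bad xJ.
pose R i (ye : fn I (w + k) * fn I k) := [/\ J i,
  [/\ fn_deg_lt k.+1 ye.1, fn_deg_lt k.+1 ye.2 & ~ B k ye.2],
  B w (pull (row_mx 1%:M 0) ye.1 - x), recurrent B f J ye.1
  & le_mod B (ye.1 + pull (col_mx 0 1%:M) ye.2) (f i)].
(* Pairs (y, e) in w + k and k variables form a finite type, so it is enough to find one pair for
   each of infinitely many i. *)
suff /infinitely_pigeonhole[[y e] Hye] : infinitely (fun i => exists ye, R i ye).
  have [_ _ [_ [Hy He Be] yx yJ _]] := Hye 0%N; exists y, e; split=> //.
  by apply: infinitely_sub Hye => i [].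
move=> N.
pose J' j := [/\ (N <= j)%N, J j & le_mod B x (f j)].
have J'inf : infinitely J'.
  move=> N'; have [j] := xJ (maxn N N').
  by rewrite geq_max => /andP[Nj N'j] [Jj xf]; exists j.
(* [phi j] restricts [f j] to x modulo B; the default 0 is met only when x is not below [f j]. *)
pose phi j : 'M['F_p]_(w, d j) :=
  if pselect (le_mod B x (f j)) is left h then projT1 (cid h) else 0.
have phiP j : J' j -> B w (pull (phi j) (f j) - x).
  case=> _ _ xf; rewrite /phi; case: pselect => // h.
  by apply: (sub_opp p_prime HB); apply: (projT2 (cid h)).
pose z j : fn I (w + d j) := pull (col_mx (phi j) 1%:M) (f j).
have Hz j : fn_deg_lt k.+1 (z j) by apply: fn_deg_lt_pull.
have zf j : le_mod B (z j) (f j) by apply: (le_mod_pull HB).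
(* [shift_diff] maps B onto a subfunctor of degree below k, so the induction gives an i for which
   the differences of [z i] are, modulo it, restrictions of those of infinitely many [z j]. *)
have [i [Ni Ji xf] qi] := IHk _ _ (shift_diff_subfunctor w HB) d
  (fun j => shift_diff (z j)) J' (fun j => shift_diff_deg (Hz j)) J'inf.
pose Q j (ye : fn I (w + d i) * fn I (d i)) := [/\ J j /\ le_mod B ye.1 (f j),
  fn_deg_lt k.+1 ye.1, fn_deg_lt k.+1 ye.2, B w (pull (row_mx 1%:M 0) ye.1 - x)
  & B _ (z i - (ye.1 + pull (col_mx 0 1%:M) ye.2))].
have /infinitely_pigeonhole[[y e] Hye] : infinitely (fun j => exists ye, Q j ye).
  apply: infinitely_sub qi => j [J'j [M [b Bb Eb]]].
  pose y := pull (block_mx 1%:M 0 0 M) (z j).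
  (* The correction b in B makes the differences of [z i] and y agree, so c depends on the new
     variables only. *)
  pose c := z i - y - b.
  have cE : shift_diff c = 0.
    by rewrite !shift_diffB -Eb -shift_diff_pull subrr.
  have Hy : fn_deg_lt k.+1 y by apply: fn_deg_lt_pull.
  exists (y, pull (row_mx 0 1%:M) c); split=> //=.
  - case: J'j => _ Jj _; split=> //.
    by apply: (le_mod_trans HB) (zf j); apply: (le_mod_pull HB).
  - apply/fn_deg_lt_pull/fn_deg_ltB; last exact: (sub_deg HB).
    exact: fn_deg_ltB.
  - rewrite !pull_pull mul_row_block !mul1mx !mul0mx !addr0.
    by rewrite mul_row_col mul1mx mul0mx addr0; apply: phiP.
  - by rewrite -(shift_diff_eq0 cE) opprD addrA /c opprB addrC subrK.
have [_ _ [_ /= Hy He yx zye]] := Hye 0%N.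
have yJ : recurrent B f J y by apply: infinitely_sub Hye => j [].
(* If e were in B, [f i] would be a restriction of the recurrent y modulo B, against [bad]. *)
have Be : ~ B _ e.
  move=> Be; apply: (bad i Ji); apply: (recurrent_le HB) yJ.
  apply: (le_mod_trans HB (g := z i)).
    exists (row_mx 0 1%:M).
    rewrite pull_pull mul_row_col mul0mx add0r mulmx1 pull1 subrr.
    exact: (sub0 HB).
  apply: le_mod_congr.
  have := subD HB zye (sub_pull HB (col_mx 0 1%:M) Be).
  by rewrite opprD addrA subrK.
(* Cutting e down to k variables makes the number of variables independent of i. *)
have /existsNP[C BC] : ~ forall C : 'M['F_p]_(k, d i), B k (pull C e).
  by move=> all; apply: Be; apply: (sub_generated p_prime HB).
exists i => //; exists (pull (block_mx 1%:M 0 0 C) y, pull C e); split=> //=.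
- by split=> //; apply: fn_deg_lt_pull.
- by rewrite pull_pull mul_row_block !mul1mx !mul0mx !addr0.
- by apply: (recurrent_le HB) yJ; apply: (le_mod_pull HB).
- apply: (le_mod_trans HB) (zf i); exists (block_mx 1%:M 0 0 C).
  have := sub_pull HB (block_mx 1%:M 0 0 C) zye.
  rewrite pullB => /(sub_opp p_prime HB).
  rewrite pullD [pull _ (pull (col_mx _ _) e)]pull_pull mul_block_col.
  by rewrite pull_pull mul_col_mx !mulmx0 !mul0mx !add0r mulmx1 mul1mx.
Qed.

(* Iterating [recurrent_extend] N times, [theta t] reads the new coordinates along
   (t_1 u, ..., t_N u); the witness [e] is the one of the last step s with
   t_s <> 0. *)
Lemma recurrent_extend_iter (I : finType) k (B : forall n, fn I n -> Prop)
    (d : nat -> nat) (f : forall j, fn I (d j)) (J : nat -> Prop) w (x : fn I w) N :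
  wqo_at k -> subfunctor k.+1 B -> (forall j, fn_deg_lt k.+1 (f j)) ->
  (forall i, J i -> ~ recurrent B f J (f i)) ->
  fn_deg_lt k.+1 x -> recurrent B f J x ->
  exists m (y : fn I m) (theta : 'rV['F_p]_N -> 'M['F_p]_(w + k, m)),
    [/\ fn_deg_lt k.+1 y /\ recurrent B f J y,
        forall v, exists (A : 'M_(N, m)) c, forall t, v *m theta t = t *m A + c,
        B _ (pull (theta 0) y - pull (col_mx 1%:M 0) x)
      & forall t, t != 0 -> exists2 e : fn I k, fn_deg_lt k.+1 e /\ ~ B k e &
          recurrent B f J (pull (theta t) y + pull (col_mx 0 1%:M) e)].
Proof.
move=> IHk HB Hf bad Hx xJ; elim: N => [|N [m [y [theta [[Hy yJ] aff th0 tht]]]]].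
  exists w, x, (fun=> col_mx 1%:M 0); split=> //.
  - by move=> v; exists 0, (v *m col_mx 1%:M 0) => t; rewrite mulmx0 add0r.
  - by rewrite subrr; apply: (sub0 HB).
  - by move=> t; rewrite thinmx0 eqxx.
have [z [e [Hz [He Be] zy zJ zeJ]]] := recurrent_extend IHk HB Hf bad yJ.
pose tau (t : 'rV['F_p]_(N + 1)) := rsubmx t 0 0.
pose theta' t : 'M['F_p]_(w + k, m + k) :=
  row_mx (theta (lsubmx t)) (col_mx 0 (tau t)%:M).
have zth t : tau t = 0 -> B _ (pull (theta' t) z - pull (theta (lsubmx t)) y).
  move=> t0; have := sub_pull HB (theta (lsubmx t)) zy.
  rewrite pullB pull_pull mul_mx_row mulmx1 mulmx0 /theta' t0.
  by rewrite (_ : col_mx 0 0%:M = 0) // raddf0 col_mx0.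
rewrite -[N.+1]addn1; exists (m + k)%N, z, theta'; split=> //.
- move=> v; have [A [c Ac]] := aff v.
  exists (block_mx A 0 0 (rsubmx v)), (row_mx c 0) => t.
  rewrite /theta' mul_mx_row Ac -{1}[v]hsubmxK mul_row_col mulmx0 add0r.
  rewrite -[X in X *m block_mx _ _ _ _]hsubmxK mul_row_block !mulmx0 addr0 add0r.
  rewrite add_row_mx addr0; congr row_mx.
  by rewrite [rsubmx t]mx11_scalar mul_mx_scalar mul_scalar_mx.
- have := zth 0; rewrite /tau !linear0 mxE => /(_ erefl) H.
  by have := subD HB H th0; rewrite addrA subrK.
- move=> t t0; have [tau0|tau0] := eqVneq (tau t) 0.
    have [|e' He' e'J] := tht (lsubmx t).
      apply: contra_neq t0 => l0; rewrite -[t]hsubmxK l0.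
      by rewrite [rsubmx t]mx11_scalar -/(tau t) tau0 raddf0 row_mx0.
    exists e' => //; apply: (recurrent_le HB) e'J; apply: le_mod_congr.
    by rewrite opprD addrACA subrr addr0; apply: zth.
  (* Along [theta' t] the last e is read at [tau t] times u; undoing the scaling shows that it stays
     outside B. *)
  exists (pull (tau t)%:M e).
    split; first exact: fn_deg_lt_pull.
    move=> Bte; apply: Be; have := sub_pull HB (tau t)^-1%:M Bte.
    by rewrite pull_pull -scalar_mxM mulVf // pull1.
  apply: (recurrent_le HB) zeJ; exists (theta' t).
  rewrite pullD opprD addrACA subrr add0r !pull_pull.
  rewrite mul_row_col mulmx0 add0r mulmx1 mul_col_mx mul0mx mul1mx subrr.
  exact: (sub0 HB).
Qed.

(** As [theta] is affine, each value of [pull (theta t) y] has degree at most k in t. N exceeds k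
    times the number of values, so Chevalley-Warning finds t <> 0 with the same values as at 0,
    those of x modulo B. *)
Lemma exists_recurrent_oplus (I : finType) k (B : forall n, fn I n -> Prop)
    (d : nat -> nat) (f : forall j, fn I (d j)) (J : nat -> Prop) w (x : fn I w) :
  wqo_at k -> subfunctor k.+1 B -> (forall j, fn_deg_lt k.+1 (f j)) ->
  (forall i, J i -> ~ recurrent B f J (f i)) ->
  fn_deg_lt k.+1 x -> recurrent B f J x ->
  exists2 e : fn I k, fn_deg_lt k.+1 e /\ ~ B k e & recurrent B f J (oplus x e).
Proof.
move=> IHk HB Hf bad Hx xJ.
have [m [y [theta [[Hy yJ] aff th0 tht]]]] :=
  recurrent_extend_iter (#|{: 'rV['F_p]_(w + k) * I}| * k).+1 IHk HB Hf bad Hx xJ.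
have [|t t0 Et] := chevalley_warning p_prime
    (g := fun t (vi : 'rV['F_p]_(w + k) * I) => pull (theta t) y vi) _ (ltnSn _).
  move=> [v i]; have [A [c Ac]] := aff v.
  have AL t h : (t + h) *m A + c = t *m A + c + h *m A.
    by rewrite mulmxDl addrAC.
  by apply: deg_lt_ext (deg_lt_comp AL (Hy i)) => t; rewrite ffunE /= Ac.
have [e He eJ] := tht t t0; exists e => //.
apply: (recurrent_le HB) eJ; apply: le_mod_congr.
have -> : pull (theta t) y = pull (theta 0) y by apply/ffunP.
apply: (sub_opp p_prime HB).
by rewrite opprD addrACA subrr addr0.
Qed.

Lemma wqo_step k : wqo_at k -> wqo_at k.+1.
Proof.
move=> IHk I B; move: {2}#|[set e : fn I k | ~~ `[< B k e >]]|.+1 (ltnSn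
  #|[set e : fn I k | ~~ `[< B k e >]]|) => s.
elim: s B => // s IHs B Bs HB d f J0 Hf J0inf; apply: contrapT => nogood.
have bad (J : nat -> Prop) : (forall j, J j -> J0 j) ->
    forall i, J i -> ~ recurrent B f J (f i).
  move=> JJ i Ji fi; apply: nogood; exists i; first exact: JJ.
  exact: recurrent_sub fi.
pose L (J : nat -> Prop) w (x : fn I w) :=
  [set e : fn I k | `[< fn_deg_lt k.+1 e /\ recurrent B f J (oplus x e) >]].
pose P n := `[< exists J w (x : fn I w), [/\ forall j, J j -> J0 j,
  fn_deg_lt k.+1 x, recurrent B f J x & #|L J w x| = n] >].
have exP : exists n, P n.
  (* There are finitely many functions on F_p^0, so some restriction to the origin recurs. *)
  have [|x Hx] := @infinitely_pigeonhole (fn I 0)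
      (fun j x => [/\ J0 j, fn_deg_lt k.+1 x & le_mod B x (f j)]).
    apply: infinitely_sub J0inf => j J0j; exists (pull 0 (f j)); split=> //.
      exact: fn_deg_lt_pull.
    exact: (le_mod_pull HB).
  exists #|L J0 0 x|; apply/asboolP; exists J0, 0, x.
  have [_ _ [_ degx _]] := Hx 0; split=> //.
  by apply: infinitely_sub Hx => j [].
have [n /asboolP[J [w [x [JJ0 Hx xJ Ln]]]] minL] := ex_minnP exP.
pose J1 j := J j /\ le_mod B x (f j).
have J1J j : J1 j -> J j by case.
have absorb m (y : fn I m) e : recurrent B f J1 y -> e \in L J w x ->
    recurrent B f J1 (oplus y e).
  have xJ1 j : J1 j -> le_mod B x (f j) by case.
  (* Some recurrent z lies above both x and y; minimality forces [L J1 l z] to equal [L J w x], so e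
     may be added to z and hence to y. *)
  move=> yJ1; have [l [z [zJ1 xz yz]]] := recurrent_join HB xJ1 yJ1.
  have Hz : fn_deg_lt k.+1 z by apply: recurrent_deg zJ1.
  have sub : L J1 l z \subset L J w x.
    apply/subsetP => e' /[!inE] /asboolP[He' ze'].
    apply/asboolP; split=> //.
    exact/(recurrent_sub J1J)/(recurrent_le HB (le_mod_oplus HB _ xz)).
  have /eqP <- : L J1 l z == L J w x.
    rewrite eqEcard sub Ln minL //; apply/asboolP.
    by exists J1, l, z; split=> // j /J1J/JJ0.
  rewrite inE => /asboolP[_]; apply: (recurrent_le HB).
  exact: (le_mod_oplus HB).
have [e0 [He0 Be0] xe0] := exists_recurrent_oplus IHk HB Hf (bad J JJ0) Hx xJ.
(* B' collects the functions of degree at most k whose pullbacks preserve recurrence when added. It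
   contains B and [e0], so fewer functions on F_p^k lie outside it. *)
pose B' n (g : fn I n) := fn_deg_lt k.+1 g /\
  forall m (y : fn I m) (C : 'M_(m, n)),
    recurrent B f J1 y -> recurrent B f J1 (y + pull C g).
have BB' n' (g : fn I n') : B n' g -> B' n' g.
  move=> Bg; split=> [|m y C]; first exact: (sub_deg HB).
  apply: (recurrent_le HB); apply: le_mod_congr; rewrite addrAC subrr add0r.
  exact: (sub_pull HB).
have HB' : subfunctor k.+1 B'.
  split=> [n'|n' g h [Hg Bg] [Hh Bh]|l m M g [Hg Bg]|n' g []//].
  - exact/BB'/(sub0 HB).
  - split=> [|m y C yJ1]; first exact: fn_deg_ltD.
    by rewrite pullD addrA; apply/Bh/Bg.
  - split=> [|m' y C yJ1]; first exact: fn_deg_lt_pull.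
    by rewrite pull_pull; apply: Bg.
have B'e0 : B' k e0.
  split=> // m y C yJ1; apply: (recurrent_le HB (y := oplus y e0)).
    exists (row_mx 1%:M C); rewrite pull_oplus pull1 subrr; exact: (sub0 HB).
  by apply: absorb => //; rewrite inE; apply/asboolP.
have [||i J1i fi] := IHs B' _ HB' d f J1 Hf.
- rewrite -ltnS; apply: leq_trans Bs; rewrite ltnS; apply: proper_card.
  apply/properP; split.
    apply/subsetP => e /[!inE]; apply: contra => /asboolP/BB' ?.
    exact/asboolP.
  by exists e0; rewrite !inE; [apply/asboolP | rewrite negbK; apply/asboolP].
- exact: recurrent_infinitely (recurrent_restrict xJ).
apply: (bad J1) (J1i) _; first by move=> j /J1J/JJ0.
(* Finiteness gives one y below infinitely many [f j] with [f i - y] in B'; adding this to the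
   recurrent y makes [f i] recurrent. *)
have [|y Hy] := @infinitely_pigeonhole (fn I (d i))
    (fun j y => [/\ J1 j, le_mod B y (f j) & B' _ (f i - y)]).
  apply: infinitely_sub fi => j [J1j [M B'M]]; exists (pull M (f j)); split=> //.
  exact: (le_mod_pull HB).
have [_ _ [_ _ [_ B'y]]] := Hy 0.
rewrite -[f i](subrK y) addrC -[f i - y]pull1; apply: B'y.
by apply: infinitely_sub Hy => j [].
Qed.

Theorem wqo k : wqo_at k.
Proof.
elim: k => [|k]; last exact: wqo_step.
move=> I B HB d f J Hf Jinf; have [i _ Ji] := Jinf 0; exists i => //.
have f0 j : f j = 0 by apply/ffunP => -[v i']; rewrite Hf ffunE.
apply: infinitely_sub Jinf => j Jj; split=> //; exists 0.
by rewrite !f0 pull0 subrr; apply: (sub0 HB).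
Qed.

End WellQuasiOrder.

(** * Polynomial functions, affine maps and hyperplanes *)

Section PolynomialFunctions.
Set Implicit Arguments.
Unset Strict Implicit.
Unset Printing Implicit Defensive.
Import GRing.Theory.
Local Open Scope ring_scope.
Variable p : nat.
Local Notation fn I n := {ffun ('rV['F_p]_n * I)%type -> 'F_p}.

Lemma affine_diff m n (A : 'rV['F_p]_m -> 'rV['F_p]_n) :
  affine_map A -> exists L, forall v h, A (v + h) = A v + L h.
Proof.
by move=> [M [b AE]]; exists (mulmx^~ M) => v h; rewrite !AE mulmxDl addrAC.
Qed.

Lemma poly_fun_deg_lt n d (P : 'rV['F_p]_n -> 'F_p) :
  poly_fun_deg_le d P -> deg_lt d.+1 P.
Proof.
move=> [q [qd PE]].
apply: (@deg_lt_ext _ _ _ (fun x : 'rV['F_p]_n =>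
    \sum_(m <- msupp q) q@_m * \prod_i x 0 i ^+ m i)) => [x|].
  by rewrite PE mevalE.
apply: deg_lt_sum => m /msize_mdeg_lt mq.
apply: (@deg_lt_leq _ _ (0 + mdeg m).+1); first exact: leq_trans mq qd.
apply: deg_ltM; first exact: deg_lt_const.
rewrite mdegE; apply: deg_lt_prod => i.
have Xi : deg_lt 2 (fun x : 'rV['F_p]_n => x 0 i).
  move=> h; apply: deg_lt_ext (@deg_lt_const _ _ 0 (h 0 i)) => v.
  by rewrite /diff mxE [v 0 i + _]addrC addrK.
by have := deg_ltX (m i) Xi; rewrite muln1.
Qed.

Lemma msize_sum_le n d (T : eqType) (r : seq T) (F : T -> {mpoly 'F_p[n]}) :
  (forall i, i \in r -> (msize (F i) <= d)%N) -> (msize (\sum_(i <- r) F i)%R <= d)%N.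
Proof.
move=> HF; rewrite big_seq; elim/big_rec: _ => [|i q ir qd]; first by rewrite msize0.
by apply: leq_trans (msizeD_le _ _) _; rewrite geq_max HF.
Qed.

Lemma msizeM_leq n k l (q r : {mpoly 'F_p[n]}) :
  (msize q <= k.+1)%N -> (msize r <= l.+1)%N -> (msize (q * r)%R <= (k + l).+1)%N.
Proof.
have [->|q0] := eqVneq q 0; first by rewrite mul0r msize0.
have [->|r0] := eqVneq r 0; first by rewrite mulr0 msize0.
rewrite msizeM // => qk rl.
have : (msize q + msize r <= k.+1 + l.+1)%N by apply: leq_add.
by rewrite addSn addnS; case: (_ + _)%N.
Qed.

Lemma msize_comp_affine m n (q : {mpoly 'F_p[n]}) (lq : n.-tuple {mpoly 'F_p[m]}) :
  (forall i, (msize (tnth lq i) <= 2)%N) -> (msize (q \mPo lq) <= msize q)%N.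
Proof.
move=> Hlq; rewrite comp_mpolyEX; apply: msize_sum_le => e /msize_mdeg_lt eq.
apply: leq_trans (msizeZ_le _ _) (leq_trans _ eq).
rewrite comp_mpolyX mdegE; elim/big_rec2: _ => [|i r k _ IH]; first by rewrite msize1.
apply: msizeM_leq => //.
elim: (e i) => [|a IHa]; first by rewrite msize1.
by rewrite exprS; apply: (@msizeM_leq _ 1 a).
Qed.

Lemma poly_fun_deg_le_affine m n d (P : 'rV['F_p]_n -> 'F_p)
    (A : 'rV['F_p]_m -> 'rV['F_p]_n) :
  affine_map A -> poly_fun_deg_le d P -> poly_fun_deg_le d (P \o A).
Proof.
move=> [M [b AE]] [q [qd PE]].
pose lq := [tuple \sum_j M j i *: 'X_j + (b 0 i)%:MP_[m] | i < n].
exists (q \mPo lq); split=> [|x].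
  apply: leq_trans (msize_comp_affine _ _) qd => i; rewrite tnth_mktuple.
  apply: leq_trans (msizeD_le _ _) _; rewrite geq_max; apply/andP; split.
    apply: msize_sum_le => j _; apply: leq_trans (msizeZ_le _ _) _.
    by rewrite msizeX mdeg1.
  by rewrite msizeC; case: (_ != 0).
rewrite comp_mpoly_meval /= PE; apply: meval_eq => i.
rewrite tnth_mktuple AE !mxE mevalD mevalC; congr (_ + _).
rewrite raddf_sum /=; apply: eq_bigr => j _.
by rewrite mevalZ mevalXU mulrC.
Qed.

Lemma structured_affine c d (Gamma : 'rV['F_p]_c -> 'F_p) m n
    (F : 'rV['F_p]_n -> 'F_p) (A : 'rV['F_p]_m -> 'rV['F_p]_n) :
  affine_map A -> structured d Gamma F -> structured d Gamma (F \o A).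
Proof.
move=> HA [P [HP FE]]; exists (fun i => P i \o A); split=> [i|x] /=.
  exact: poly_fun_deg_le_affine.
by rewrite FE.
Qed.

Lemma degree_structural_affine sigma Delta (PP : property p) :
  degree_structural sigma Delta PP ->
  forall m n (F : 'rV['F_p]_n -> 'F_p) (A : 'rV['F_p]_m -> 'rV['F_p]_n),
  affine_map A -> PP n F -> PP m (F \o A).
Proof.
move=> [S [_ HS]] m n F A HA /HS[c [d [Gamma [Scd HF]]]].
by apply/HS; exists c, d, Gamma; split=> //; apply: structured_affine.
Qed.

Lemma hyperplane_eq n (c : 'cV['F_p]_n) (a : 'F_p) :
  c != 0 -> hyperplane [set x | (x *m c) 0 0 == a].
Proof.
move=> c0; have [i ci] : exists i, c i 0 != 0.
  by have /matrix0Pn[i [j]] := c0; rewrite ord1; exists i.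
(* Since w c = 1, the set is the translate by a w of the kernel of c. *)
pose w : 'rV['F_p]_n := (c i 0)^-1 *: delta_mx 0 i.
have wc : w *m c = 1%:M.
  rewrite /w -scalemxAl -rowE; apply/matrixP => k l.
  by rewrite !ord1 !mxE mulVf.
pose f := linfun (mulmxr c) : 'Hom('rV['F_p]_n, 'rV['F_p]_1).
exists (a *: w), (lker f); split.
  have := limg_ker_dim f fullv; rewrite capfv dimvf /dim /= mul1n => kd.
  apply: etrans kd.
  suff -> : \dim (limg f) = 1%N by rewrite addn1.
  apply/eqP; rewrite eqn_leq; apply/andP; split.
    by apply: leq_trans (dimvS (subvf _)) _; rewrite dimvf.
  rewrite lt0n dimv_eq0; apply/negP => /eqP f0.
  have : f w \in limg f by apply/memv_img/memvf.
  rewrite f0 memv0 lfunE /= wc => /eqP/matrixP/(_ 0 0)/eqP.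
  by rewrite !mxE oner_eq0.
apply/setP => x; rewrite inE; apply/eqP/imsetP => [xa|[u]].
  exists (x - a *: w); last by rewrite addrC subrK.
  rewrite memv_ker lfunE /= mulmxBl -scalemxAl wc; apply/eqP/matrixP => k l.
  by rewrite !ord1 [LHS]mxE xa !mxE mulr1 subrr.
rewrite memv_ker lfunE /= => /eqP uc ->.
by rewrite mulmxDl uc addr0 -scalemxAl wc !mxE mulr1.
Qed.

(** An injective affine [phi] has a linear part of full row rank, hence an affine left inverse. *)
Lemma restriction_inv n (F : 'rV['F_p]_n -> 'F_p) (H : {set 'rV['F_p]_n}) G :
  restriction F H G ->
  exists2 psi : 'rV['F_p]_n -> 'rV['F_p]_n.-1,
    affine_map psi & forall x, x \in H -> F x = G (psi x).
Proof.
move=> [phi [[M [b phiE]] inj <- GE]].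
have freeM : row_free M.
  apply: inj_row_free => v vM; apply: inj; rewrite !phiE vM mul0mx //.
exists (fun y => (y - b) *m pinvmx M).
  by exists (pinvmx M), (- b *m pinvmx M) => x; rewrite mulmxDl.
by move=> _ /imsetP[u _ ->]; rewrite {2}phiE addrK mulmxKp.
Qed.

Lemma exists_kernel m n (M : 'M['F_p]_(m, n)) :
  (m < n)%N -> exists2 c : 'cV['F_p]_n, c != 0 & M *m c = 0.
Proof.
move=> mn; have : kermx M^T != 0.
  rewrite -mxrank_eq0 mxrank_ker subn_eq0 -ltnNge.
  by apply: leq_ltn_trans mn; rewrite mxrank_tr rank_leq_row.
case/rowV0Pn => v /sub_kermxP vM v0; exists v^T.
  by rewrite -trmx0 (inj_eq (can_inj (@trmxK _ _ _))).
by rewrite -[M]trmxK -trmx_mul vM trmx0.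
Qed.

(** The polynomials on H extend to the whole space along [psi], and the tuple is padded with zeros
    to the uniform length sigma. *)
Lemma restriction_structured sigma Delta (PP : property p) n
    (F : 'rV['F_p]_n -> 'F_p) (H : {set 'rV['F_p]_n}) G :
  degree_structural sigma Delta PP -> restriction F H G -> PP n.-1 G ->
  exists (Q : 'I_sigma -> 'rV['F_p]_n -> 'F_p)
         (Gamma : {ffun 'I_sigma -> 'F_p} -> 'F_p),
    (forall i, deg_lt Delta.+1 (Q i)) /\
    forall x, x \in H -> F x = Gamma [ffun i => Q i x].
Proof.
move=> [S [Sb HS]] /restriction_inv[psi psiA FG].
case/HS=> c [d [Gamma [Scd [P [HP GE]]]]].
have [/andP[_ c_sigma] d_Delta] := Sb _ _ _ Scd.
exists (fun i x => if insub (i : nat) is Some j then P j (psi x) else 0).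
exists (fun u => Gamma (\row_j u (widen_ord c_sigma j))); split=> [i|x xH].
  case: insub => [j|]; last exact: deg_lt0.
  have [L psiL] := affine_diff psiA.
  have := deg_lt_comp psiL (poly_fun_deg_lt (HP j)).
  by apply: deg_lt_leq; rewrite ltnS.
rewrite FG // GE; congr Gamma; apply/rowP => j; rewrite !mxE ffunE.
by rewrite (valK j : insub (widen_ord c_sigma j : nat) = Some j).
Qed.

(* [None] indexes the linear form separating p parallel hyperplanes, and
   [Some (a, i)] the i-th polynomial describing F on the a-th of them. *)
Lemma structured_of_hyperplanes sigma Delta (PP : property p) n
    (F : 'rV['F_p]_n -> 'F_p) :
  (0 < Delta)%N -> (0 < n)%N -> degree_structural sigma Delta PP ->
  (forall H, hyperplane H -> exists2 G, restriction F H G & PP n.-1 G) ->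
  exists (g : fn (option ('F_p * 'I_sigma)%type) n)
         (Gamma : {ffun {ffun option ('F_p * 'I_sigma) -> 'F_p} -> 'F_p}),
    fn_deg_lt Delta.+1 g /\ forall x, F x = Gamma [ffun i => g (x, i)].
Proof.
move=> Delta_gt0 n_gt0 HPP HF.
pose c : 'cV['F_p]_n := const_mx 1.
have c0 : c != 0.
  apply/eqP => /matrixP/(_ (Ordinal n_gt0) 0)/eqP.
  by rewrite !mxE oner_eq0.
have slice a : exists QG : ('I_sigma -> 'rV['F_p]_n -> 'F_p) *
      ({ffun 'I_sigma -> 'F_p} -> 'F_p),
    (forall i, deg_lt Delta.+1 (QG.1 i)) /\
    forall x, (x *m c) 0 0 = a -> F x = QG.2 [ffun i => QG.1 i x].
  have [G FG PG] := HF _ (hyperplane_eq a c0).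
  have [Q [Gamma [HQ QE]]] := restriction_structured HPP FG PG.
  by exists (Q, Gamma); split=> // x xa; apply: QE; rewrite inE xa.
have [QG HQG] := choice slice.
exists [ffun xi => if xi.2 is Some (a, i) then (QG a).1 i xi.1
                   else (xi.1 *m c) 0 0].
exists [ffun u : {ffun option ('F_p * 'I_sigma) -> 'F_p} =>
  (QG (u None)).2 [ffun i => u (Some (u None, i))]]; split.
  case=> [[a i]|].
    by apply: deg_lt_ext ((HQG a).1 i) => x; rewrite ffunE.
  (* A linear form has degree at most 1, which [Delta_gt0] allows. *)
  apply: (@deg_lt_leq _ _ 2) => // h.
  apply: deg_lt_ext (@deg_lt_const _ _ 0 ((h *m c) 0 0)) => x.
  by rewrite /diff !ffunE /= mulmxDl [in RHS]mxE [X in X - _]addrC addrK.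
move=> x; rewrite ffunE ((HQG ((x *m c) 0 0)).2 x erefl) !ffunE /=.
by congr (_.2 _); apply/ffunP => i; rewrite !ffunE.
Qed.

End PolynomialFunctions.

(** * Local characterization from the well-quasi-order *)

Theorem theorem1p7 (p : nat) (p_prime : prime p) (sigma Delta : nat)
    (sigma_gt0 : 0 < sigma) (Delta_gt0 : 0 < Delta) (PP : property p) :
  degree_structural sigma Delta PP ->
  affine_invariant PP /\ locally_characterized PP.
Proof.
move=> HPP; have aff := degree_structural_affine HPP.
split; first by move=> n F A PF HA; apply: aff.
split=> [n F H PF _ G [phi [phiA _ _ GE]]|].
  by rewrite (funext GE : G = F \o phi); apply: aff.
apply: contrapT => noK.
have cex K : exists nF : {n & 'rV['F_p]_n -> 'F_p},
    [/\ ~ PP _ (projT2 nF), K < projT1 nF & forall H, hyperplane H ->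
      exists2 G, restriction (projT2 nF) H G & PP _ G].
  (* [K.+1] keeps the constant at least 1 when K = 0. *)
  apply: contrapT => none; apply: noK; exists K.+1; split=> // n F PF Kn.
  apply: contrapT => noH; apply: none; exists (existT _ n F).
  split=> //= [|H Hhyp]; first exact: ltnW.
  apply: contrapT => noG; apply: noH; exists H; split=> // G FG PG.
  by apply: noG; exists G.
have [nF HnF] := choice cex.
pose n j := projT1 (nF j); pose F j : 'rV['F_p]_(n j) -> 'F_p := projT2 (nF j).
have HnF' j : [/\ ~ PP _ (F j), j < n j & forall H, hyperplane H ->
    exists2 G, restriction (F j) H G & PP _ G] := HnF j.
have repr j : exists gG : {ffun 'rV['F_p]_(n j) * option ('F_p * 'I_sigma) -> 'F_p} *
      {ffun {ffun option ('F_p * 'I_sigma) -> 'F_p} -> 'F_p},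
    fn_deg_lt Delta.+1 gG.1 /\ forall x, F j x = gG.2 [ffun i => gG.1 (x, i)].
  have [_ jn Fh] := HnF' j.
  have [g [Gamma gG]] :=
    structured_of_hyperplanes Delta_gt0 (leq_ltn_trans (leq0n j) jn) HPP Fh.
  by exists (g, Gamma).
pose g j := (projT1 (cid (repr j))).1; pose Gamma j := (projT1 (cid (repr j))).2.
have gdeg j : fn_deg_lt Delta.+1 (g j) := (projT2 (cid (repr j))).1.
have FE j : forall x, F j x = Gamma j [ffun i => g j (x, i)] :=
  (projT2 (cid (repr j))).2.
have [|Gam HGam] := @infinitely_pigeonhole _ (fun j Gam => Gamma j = Gam).
  by move=> N; exists N => //; exists (Gamma N).
(* With B = 0, [le_mod] is exact restriction. *)
have HB : subfunctor Delta.+1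
    (fun n (f : {ffun 'rV['F_p]_n * option ('F_p * 'I_sigma) -> 'F_p}) => f = 0%R).
  split=> [//|m a b -> ->|m l M a ->|m a ->]; first by rewrite GRing.addr0.
    exact: pull0.
  exact: fn_deg_lt0.
have [i Gi gi] := wqo p_prime HB gdeg HGam.
(* Asking for j at least [n i] gives n i <= j < n j, so the image of M lies in a hyperplane c =
   0. *)
have [j nij [Gj [M gij]]] := gi (n i).
have [_ jnj Fh] := HnF' j.
have [c c0 Mc] := exists_kernel M (leq_ltn_trans nij jnj).
have [G FG PG] := Fh _ (hyperplane_eq 0%R c0).
have [psi psiA FG'] := restriction_inv FG.
have [nPF _ _] := HnF' i; apply: nPF.
have psiMA : affine_map (psi \o mulmx^~ M).
  have [N [b psiE]] := psiA; exists (M *m N)%R, b => x.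
  by rewrite /= psiE mulmxA.
suff -> : F i = G \o (psi \o mulmx^~ M) by apply: aff.
apply: funext => x /=; rewrite -FG'; last first.
  by rewrite inE -mulmxA Mc mulmx0 mxE.
rewrite !FE Gi Gj; congr (Gam _); apply/ffunP => a; rewrite !ffunE.
have /ffunP/(_ (x, a)) := gij.
by rewrite !ffunE /= => /eqP; rewrite GRing.subr_eq0 => /eqP.
Qed.
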